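(* Let $D$ be a weighted oriented graph with underlying graph $G$. The following conditions are equivalent: 1) $I(D)$ is unmixed. 2) All strong vertex covers of $D$ have the same cardinality. 3) $I(G)$ is unmixed and $L_3(C)=\emptyset$ for each strong vertex cover $C$ of $D$.
   Context: A weighted oriented graph is a triplet $D=(V(D),E(D),w)$ where $V=V(D)$ is a finite set, $E=E(D)\subseteq V\times V$ is the edge set of an oriented graph (no loops, and for $x\neq y$ at most one of $(x,y),(y,x)$ is in $E$), and $w:V\to\mathbb{N}=\{1,2,\dots\}$ is the weight function. Its underlying graph $G$ is the simple graph on $V$ with edge set $\{\{x,y\}:(x,y)\in E\}$. Put $V^{+}=\{x\in V: w(x)\neq 1\}$. For $x\in V$: $N_D^{+}(x)=\{y:(x,y)\in E\}$, $N_D^{-}(x)=\{y:(y,x)\in E\}$, $N_D(x)=N_D^+(x)\cup N_D^-(x)$. A source is a vertex $x$ with $N_D(x)=N_D^+(x)$. Standing assumption: if $x$ is a source of $D$, then $w(x)=1$. Writing $V=\{x_1,\dots,x_n\}$, vertices are identified with the variables of $R=K[x_1,\dots,x_n]$, $K$ a field. The edge ideal of $D$ is $I(D)=(x_ix_j^{w(x_j)} : (x_i,x_j)\in E)\subseteq R$, and the edge ideal of $G$ is $I(G)=(x_ix_j:\{x_i,x_j\}\in E(G))\subseteq R$. An ideal is unmixed if all its associated primes have the same height. A vertex cover of $D$ is a subset $C\subseteq V$ such that for every $(x,y)\in E$, $x\in C$ or $y\in C$. For a vertex cover $C$, with $C^c=V\setminus C$, define $L_1(C)=\{x\in C: N_D^{+}(x)\cap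 C^c\neq\emptyset\}$, $L_2(C)=\{x\in C: x\notin L_1(C)\text{ and }N_D^{-}(x)\cap C^c\neq\emptyset\}$, $L_3(C)=C\setminus(L_1(C)\cup L_2(C))$. A vertex cover $C$ is strong if for each $x\in L_3(C)$ there is $(y,x)\in E$ such that $y\in L_2(C)\cup L_3(C)$ and $y\in V^{+}$. *)

(* Defs.v *)
From mathcomp Require Import all_boot all_algebra.
From mathcomp Require Import mpoly.

Set Implicit Arguments.
Unset Strict Implicit.
Unset Printing Implicit Defensive.

Import GRing.Theory.

(* The vertex set {x_1, ..., x_n} is 'I_n. *)
Record wographType (n : nat) := WOGraph {
  edge : rel 'I_n;
  weight : 'I_n -> nat;
  edge_irrefl : forall x, ~~ edge x x;
  edge_oriented : forall x y, x != y -> ~~ (edge x y && edge y x);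
  weight_gt0 : forall x, 0 < weight x
}.

Section WeightedOrientedGraph.
Variables (n : nat) (D : wographType n).
Implicit Types (x y : 'I_n) (C : {set 'I_n}).

Definition underlying : rel 'I_n := fun x y => edge D x y || edge D y x.

Definition Vplus : {set 'I_n} := [set x | weight D x != 1].

Definition Nout x : {set 'I_n} := [set y | edge D x y].
Definition Nin x : {set 'I_n} := [set y | edge D y x].
Definition Nbr x : {set 'I_n} := Nout x :|: Nin x.

(* Isolated vertices are sources as well. *)
Definition source x : bool := Nbr x == Nout x.

Definition vertex_cover C : bool :=
  [forall x, forall y, edge D x y ==> (x \in C) || (y \in C)].

Definition L1 C : {set 'I_n} := [set x in C | Nout x :&: ~: C != set0].

Definition L2 C : {set 'I_n} :=
  [set x in C | (x \notin L1 C) && (Nin x :&: ~: C != set0)].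

Definition L3 C : {set 'I_n} := C :\: (L1 C :|: L2 C).

Definition strong_vertex_cover C : bool :=
  vertex_cover C &&
  [forall x in L3 C, exists y,
    [&& edge D y x, y \in L2 C :|: L3 C & y \in Vplus]].

End WeightedOrientedGraph.

From mathcomp Require Import classical_sets.
Local Open Scope classical_set_scope.
Local Open Scope ring_scope.

(* Ideals are Prop-valued sets: the structures of ring_quotient.v only cover
   decidable proper ideals. *)
Section Ideals.
Variable R : comNzRingType.
Implicit Types (I P Q : set R).

Definition is_ideal I : Prop :=
  [/\ I 0, forall a b, I a -> I b -> I (a + b) & forall a b, I b -> I (a * b)].

Definition is_prime P : Prop :=
  [/\ is_ideal P, ~ P 1 & forall a b, P (a * b) -> P a \/ P b].

Definition ideal_gen (S : set R) : set R := smallest is_ideal S.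

(* P is prime and P = (I : f), the annihilator of the class of f in R / I. *)
Definition associated_prime I P : Prop :=
  is_prime P /\ exists f : R, P = [set a | I (a * f)].

(* P_0 < P_1 < ... < P_k = P, a strictly increasing chain of primes. *)
Definition prime_chain P (k : nat) : Prop :=
  exists c : nat -> set R,
    [/\ forall i, (i <= k)%N -> is_prime (c i),
        forall i, (i < k)%N -> c i `<` c i.+1
      & c k = P].

Definition has_height P (h : nat) : Prop :=
  prime_chain P h /\ forall k, prime_chain P k -> (k <= h)%N.

(* A prime without any (finite) height has infinite height; two such primes
   have the same height. *)
Definition same_height P Q : Prop := forall h, has_height P h <-> has_height Q h.

Definition unmixed I : Prop :=
  forall P Q, associated_prime I P -> associated_prime I Q -> same_height P Q.

End Ideals.

Section EdgeIdeals.
Variables (K : fieldType) (n : nat).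

Definition wo_edge_ideal (D : wographType n) : set {mpoly K[n]} :=
  ideal_gen [set p | exists x y, edge D x y /\ p = 'X_x * 'X_y ^+ weight D y].

Definition edge_ideal (G : rel 'I_n) : set {mpoly K[n]} :=
  ideal_gen [set p | exists x y, G x y /\ p = 'X_x * 'X_y].

End EdgeIdeals.

Arguments wo_edge_ideal K {n} D.
Arguments edge_ideal K {n} G.

(* Main.v *)
(** I(D) is a monomial ideal, so its associated primes are the ideals P_C
generated by the variables of a set C, each of the form (I(D) : x^m) for some
monomial x^m.  Such an m exists exactly when C is a strong vertex cover: take
m = w off C, m = 0 on L1(C), m = w - 1 on L2(C) and L3(C); conversely, m may
be assumed to be at least w off C, and then x_i x^m \in I(D) for i in L3(C)
produces the required edge into i.  Since I(G) is I(D) for the weight function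
1, whose strong covers are the vertex covers with L3 empty, everything reduces
to ht P_C = |C| and to the fact that every vertex cover contains one with L3
empty.

For the height, a chain of primes with top P_C extends to one ending at
(x_1, ..., x_n), so it suffices that a chain P_0 < ... < P_k has k <= n.
Choosing f_i in P_i but not in P_(i-1), the N^k monomials in the f_i with
exponents < N are linearly independent modulo P_0, and they have degree O(N);
polynomials of degree O(N) span a space of dimension O(N^n), so k <= n. *)

From mathcomp Require Import boolp classical_sets.
From mathcomp Require Import all_boot all_algebra mpoly zify.
Require Import Defs.

Set Implicit Arguments.
Unset Strict Implicit.
Unset Printing Implicit Defensive.

Import GRing.Theory.
Local Open Scope classical_set_scope.
Local Open Scope ring_scope.

(** * Ideals, primes and chains of primes in a commutative ring *)

Section IdealTheory.
Variable R : comNzRingType.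
Implicit Types (I P Q : set R).

Lemma ideal_sum I (T : Type) (r : seq T) (A : pred T) (F : T -> R) :
  is_ideal I -> (forall i, A i -> I (F i)) -> I (\sum_(i <- r | A i) F i).
Proof. by case=> I0 ID _ IF; apply: big_ind. Qed.

Lemma ideal_sub I a b : is_ideal I -> I a -> I b -> I (a - b).
Proof. by case=> _ ID IM Ia Ib; apply: ID => //; rewrite -mulN1r; apply: IM. Qed.

Lemma ideal_mulr I a b : is_ideal I -> I a -> I (a * b).
Proof. by case=> _ _ IM Ia; rewrite mulrC; apply: IM. Qed.

Lemma ideal_genP (S : set R) : is_ideal (ideal_gen S).
Proof.
split=> [J [[]]//|a b Ia Ib J SJ|a b Ib J SJ]; case: (SJ) => -[J0 JD JM] _.
  by apply: JD; [apply: Ia|apply: Ib].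
by apply: JM; apply: Ib.
Qed.

Lemma prime_prod P (T : Type) (r : seq T) (A : pred T) (F : T -> R) :
  is_prime P -> P (\prod_(i <- r | A i) F i) -> exists2 i, A i & P (F i).
Proof.
move=> [Pid P1 PM] PF; apply: contrapT => nF.
suff: ~ P (\prod_(i <- r | A i) F i) by [].
by elim/big_ind: _ => // [a b nPa nPb /PM[]//|i Ai PFi]; apply: nF; exists i.
Qed.

Lemma prime_exp P a k : is_prime P -> P (a ^+ k) -> P a.
Proof.
move=> Pp; have [_ P1 PM] := Pp; elim: k => [/P1//|k IH].
by rewrite exprS => /PM[].
Qed.

Lemma prime_chain_rcons P Q k :
  prime_chain P k -> is_prime Q -> P `<` Q -> prime_chain Q k.+1.
Proof.
move=> [c [cp cl ck]] Qp PQ; exists (fun i => if (i <= k)%N then c i else Q).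
split=> [i ik|i ik|]; last by rewrite ltnn.
  by case: ifP => [/cp|].
have [->|ne] := eqVneq i k; first by rewrite leqnn ltnn ck.
by rewrite -ltnS ik ltn_neqAle ne -ltnS ik; apply: cl; rewrite ltn_neqAle ne.
Qed.

Lemma has_height_inj P h k : has_height P h -> has_height P k -> h = k.
Proof.
by move=> [ch hmax] [ck kmax]; apply/eqP; rewrite eqn_leq kmax // hmax.
Qed.

End IdealTheory.

(** * Bound on the length of chains of primes in K[x_1, ..., x_n] *)

Section Dimension.
Variables (K : fieldType) (n : nat).
Local Notation R := {mpoly K[n]}.
Implicit Types (P Q : set R).

(** Linear independence over K of the images of the [b i] in R / P. *)
Definition free_mod P (I : finType) (b : I -> R) :=
  forall c : I -> K, P (\sum_i c i *: b i) -> forall i, c i = 0.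

Lemma idealZ P c p : is_ideal P -> P p -> P (c *: p).
Proof. by case=> _ _ PM Pp; rewrite -mul_mpolyC; apply: PM. Qed.

(** Once the coefficients at powers below f^j vanish, f^j cancels, as P is prime and f is not in P.
    Modulo Q only the coefficient of f^j then survives, and freeness modulo Q kills it. *)
Lemma free_mod_mulX P Q (I : finType) (b : I -> R) (f : R) (N : nat) :
    is_prime P -> is_ideal Q -> P `<=` Q -> Q f -> ~ P f -> free_mod Q b ->
  free_mod P (fun ij : I * 'I_N => b ij.1 * f ^+ ij.2).
Proof.
move=> Pp Qid PQ Qf nPf frb c Pc.
have [Pid P1 PM] := Pp; have [Q0 QD QM] := Qid.
suff H j : forall i (jN : (j < N)%N), c (i, Ordinal jN) = 0.
  by case=> i [j jN]; apply: H.
elim/ltn_ind: j => j IH i jN.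
pose g (l : 'I_N) := \sum_i c (i, l) *: b i.
have Eg : \sum_ij c ij *: (b ij.1 * f ^+ ij.2) = \sum_l g l * f ^+ l.
  transitivity (\sum_i \sum_l c (i, l) *: (b i * f ^+ l)).
    by rewrite pair_bigA; apply: eq_bigr => -[].
  rewrite exchange_big /=; apply: eq_bigr => l _; rewrite big_distrl /=.
  by apply: eq_bigr => k _; rewrite scalerAl.
have gl0 (l : 'I_N) : (l < j)%N -> g l = 0.
  move=> lj; rewrite /g big1 // => k _; move: lj; case: l => l lN lj.
  by rewrite IH // scale0r.
have : P ((\sum_(l < N | (j <= l)%N) g l * f ^+ (l - j)) * f ^+ j).
  move: Pc; rewrite Eg (bigID (fun l : 'I_N => (j <= l)%N)) /=.
  rewrite [X in _ + X]big1 ?addr0 => [|l]; last first.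
    by rewrite -ltnNge => /gl0->; rewrite mul0r.
  rewrite big_distrl /=; congr (P _); apply: eq_bigr => l jl.
  by rewrite -mulrA -exprD subnK.
case/PM=> [/PQ|/(prime_exp Pp)//].
rewrite (bigD1 (Ordinal jN)) //= subnn mulr1 => Qs.
apply: (frb (fun i => c (i, Ordinal jN))).
rewrite -[X in Q X](addrK
  (\sum_(l < N | (j <= l)%N && (l != Ordinal jN)) g l * f ^+ (l - j))).
apply: ideal_sub => //; apply: ideal_sum => // l /andP[jl lj].
apply: QM; have -> : (l - j)%N = (l - j).-1.+1.
  rewrite prednK // subn_gt0 ltn_neqAle jl andbT.
  by apply: contraNneq lj => jl'; apply/eqP/val_inj.
by rewrite exprS; apply: ideal_mulr.
Qed.

(** [msize] is the degree plus one, so only the d^n monomials with all exponents below d can occur;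
    a larger family has a linear relation already in R. *)
Lemma free_mod_card P (I : finType) (b : I -> R) (d : nat) :
    is_ideal P -> free_mod P b -> (forall i, (msize (b i) <= d)%N) ->
  (#|I| <= d ^ n)%N.
Proof.
case=> P0 _ _ frb bd.
rewrite -[X in (_ <= X ^ _)%N]card_ord -[X in (_ <= _ ^ X)%N]card_ord -card_ffun.
pose J := {ffun 'I_n -> 'I_d}; rewrite leqNgt; apply/negP => JI.
pose mon (f : J) := [multinom (f i : nat) | i < n].
pose A := \matrix_(i < #|I|, j < #|J|) (b (enum_val i))@_(mon (enum_val j)).
have /rowV0Pn[v /sub_kermxP vA /negP[]] : kermx A != 0.
  rewrite -mxrank_eq0 mxrank_ker subn_eq0 -ltnNge.
  exact: leq_ltn_trans (rank_leq_col A) JI.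
apply/eqP/rowP => j; rewrite mxE -[j]enum_valK.
apply: (frb (fun i => v 0 (enum_rank i))).
rewrite [X in P X](_ : _ = 0) //; apply/mpolyP => m; rewrite mcoeff0 raddf_sum /=.
have [/forallP md|] := boolP [forall i, m i < d]%N; last first.
  rewrite negb_forall => /existsP[k]; rewrite -leqNgt => dm.
  rewrite big1 // => i _; rewrite mcoeffZ; apply/eqP; rewrite mulf_eq0; apply/orP; right.
  rewrite mcoeff_eq0; apply: msize_mdeg_ge; apply: leq_trans (bd i) (leq_trans dm _).
  by rewrite mdegE (bigD1 k) //= leq_addr.
have := congr1 (fun B : 'M_(_, _) => B 0 (enum_rank ([ffun i => Ordinal (md i)] : J))) vA.
rewrite !mxE => E; rewrite -[RHS]E.
rewrite [RHS](reindex (@enum_rank I)) /=; last exact/onW_bij/enum_rank_bij.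
apply: eq_bigr => i _; rewrite mxE !enum_rankK mcoeffZ; congr (_ * _@__).
by apply/mnmP => k; rewrite mnmE ffunE.
Qed.

(** Induction from the bottom of the chain: a family free modulo [c 1] is multiplied by the powers
    f^j, j < N, of some f in [c 1] outside [c 0]. For the count of dimensions, E must not depend on
    N. *)
Lemma prime_chain_free k (c : nat -> set R) :
    (forall i, (i <= k)%N -> is_prime (c i)) ->
    (forall i, (i < k)%N -> c i `<` c i.+1) ->
  exists E, forall N, exists (I : finType) (b : I -> R),
    [/\ #|I| = (N ^ k)%N, forall i, (msize (b i) <= (E * N).+1)%N
      & free_mod (c 0%N) b].
Proof.
elim: k c => [|k IH] c cp cl.
  exists 0%N => N; exists 'I_1, (fun _ => 1).
  split=> [|_|a]; rewrite ?card_ord ?expn0 ?msize1 // big_ord1 => Pa i.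
  rewrite (ord1 i).
  have [[_ _ PM] P1 _] := cp _ (leqnn 0); apply: contrapT => /eqP a0.
  apply: P1; have := PM (a ord0)^-1%:MP _ Pa.
  by rewrite mul_mpolyC scalerA mulVf // scale1r.
have [E HE] := IH (fun i => c i.+1) (fun i => cp i.+1) (fun i => cl i.+1).
have [cc ncc] := cl 0%N isT.
have {ncc}[f cf ncf] : exists2 f, c 1%N f & ~ c 0%N f.
  apply: contrapT => nf; apply: ncc => f cf.
  by apply: contrapT => ncf; apply: nf; exists f.
exists (E + msize f)%N => N; have [I [b [cI bE bfr]]] := HE N.
exists (prod I 'I_N), (fun ij : I * 'I_N => b ij.1 * f ^+ ij.2).
split; first by rewrite card_prod cI card_ord expnSr.
  case=> i j /=.
  have msM (p q : R) d e : (msize p <= d.+1)%N -> (msize q <= e.+1)%N ->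
      (msize (p * q) <= (d + e).+1)%N.
    move=> pd qe; have [->|p0] := eqVneq p 0; first by rewrite mul0r msize0.
    have [->|q0] := eqVneq q 0; first by rewrite mulr0 msize0.
    by rewrite msizeM // -ltnS; move: (msize p) (msize q) pd qe => *; lia.
  rewrite mulnDl; apply: (msM) => //.
  apply: (@leq_trans (msize f * j).+1); last first.
    by rewrite ltnS leq_mul2l ltnW ?orbT.
  elim: (nat_of_ord j) => [|l IHl]; first by rewrite expr0 msize1.
  by rewrite exprS mulnS; apply: (msM).
by apply: (free_mod_mulX _ _ cc cf ncf bfr); [apply: cp|case: (cp 1%N)].
Qed.

Lemma prime_chain_leq P k : prime_chain P k -> (k <= n)%N.
Proof.
move=> [c [cp cl _]]; have [E HE] := prime_chain_free cp cl.
(* With this N, k > n is absurd: (E N + 1)^n <= (E + 1)^n N^n < N^(n+1) <= N^k. *)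
have [I [b [cI bE bfr]]] := HE (E.+1 ^ n).+1.
have [c0 _ _] := cp 0%N isT.
have := free_mod_card c0 bfr bE; rewrite cI leqNgt; apply: contraNleq => nk.
set N := (E.+1 ^ n).+1.
have EN : ((E * N).+1 <= E.+1 * N)%N by rewrite mulSn; lia.
have leX : ((E * N).+1 ^ n <= (E.+1 * N) ^ n)%N.
  by have [->|n0] := posnP n; rewrite ?expn0 ?leq_exp2r.
apply: leq_ltn_trans leX _; rewrite expnMn.
apply: (@leq_trans (N ^ n.+1)); last by rewrite leq_pexp2l.
by rewrite expnS ltn_pmul2r ?expn_gt0.
Qed.

End Dimension.

(** * Monomial ideals, their associated primes, and the height of P_C *)

Section MonomialIdeals.
Variables (K : fieldType) (n : nat).
Local Notation R := {mpoly K[n]}.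
Implicit Types (M : 'X_{1..n} -> bool) (C : {set 'I_n}) (P : set R).

Definition mono_ideal M : set R :=
  [set p | forall m, m \in msupp p -> M m].

Definition upward M := forall m m', M m -> M (m + m')%MM.

Definition meets C (m : 'X_{1..n}) := [exists i in C, 0 < m i]%N.

Lemma mono_idealP M : upward M -> is_ideal (mono_ideal M).
Proof.
move=> upM; split=> [m|p q Ip Iq m|p q Iq m]; first by rewrite msupp0.
  by move/msuppD_le; rewrite mem_cat => /orP[/Ip|/Iq].
by case/msuppM_le/allpairsP=> -[m1 m2] /= [_ /Iq ? ->]; rewrite addmC; apply: upM.
Qed.

Lemma mono_idealX M m : mono_ideal M 'X_[m] <-> M m.
Proof.
split=> [|Mm k]; first by apply; rewrite msuppX inE.
by rewrite msuppX inE => /eqP->.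
Qed.

Lemma mono_ideal_mulX M (p : R) m :
  mono_ideal M (p * 'X_[m]) <-> mono_ideal (fun k => M (m + k)%MM) p.
Proof.
split=> [H k kp|H k]; last first.
  by rewrite (perm_mem (msuppMX _ _)) => /mapP[l /H ? ->].
by apply: H; rewrite (perm_mem (msuppMX _ _)) map_f.
Qed.

Lemma meetsD C m m' : meets C (m + m')%MM = meets C m || meets C m'.
Proof.
apply/idP/orP=> [/existsP[i /andP[iC]]|].
  rewrite mnmDE addn_gt0 => /orP[] h; [left|right];
    by apply/existsP; exists i; rewrite iC.
by case=> /existsP[i /andP[iC h]]; apply/existsP; exists i;
  rewrite iC mnmDE addn_gt0 h ?orbT.
Qed.

Lemma meets_up C : upward (meets C).
Proof. by move=> m m'; rewrite meetsD => ->. Qed.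

Lemma ideal_msupp P p : is_ideal P ->
  (forall m, m \in msupp p -> P 'X_[m]) -> P p.
Proof.
move=> Pid Pm; rewrite (mpolyE p) big_seq; apply: ideal_sum => // m mp.
by apply: idealZ => //; apply: Pm.
Qed.

(** The prime P_C generated by the variables of C. *)
Definition face C : set R := mono_ideal (meets C).

(** P_C is the kernel of the endomorphism [phi] sending the variables of C to 0, and R is a
    domain. *)
Lemma face_prime C : is_prime (face C).
Proof.
pose h i : R := if i \in C then 0 else 'X_i.
pose phi : {rmorphism R -> R} := mmap (@mpolyC n K) h.
have phiX m : phi 'X_[m] = if meets C m then 0 else 'X_[m].
  rewrite /phi /= mmapX /mmap1; case: ifP => [/existsP[i /andP[iC mi]]|].
    by rewrite (bigD1 i) //= /h iC expr0n eqn0Ngt mi mul0r.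
  move=> nm; rewrite mpolyXE_id; apply: eq_bigr => i _; rewrite /h; case: ifP => // iC.
  have -> : m i = 0%N.
    by apply: contraFeq nm; rewrite -lt0n => mi; apply/existsP; exists i; rewrite iC.
  by rewrite !expr0.
have phiE p m : (phi p)@_m = if meets C m then 0 else p@_m.
  have -> : phi p = \sum_(k <- msupp p) p@_k *: phi 'X_[k].
    rewrite {1}(mpolyE p) (raddf_sum phi); apply: eq_bigr => k _.
    by rewrite -[RHS]mul_mpolyC; apply: mmapZ.
  rewrite raddf_sum.
  transitivity (\sum_(k <- msupp p) if meets C m then 0 else (p@_k *: 'X_[k])@_m).
    apply: eq_bigr => k _; rewrite phiX /= !mcoeffZ; case: (eqVneq k m) => [->|km].
      by case: ifP; rewrite ?mcoeff0 ?mulr0.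
    by case: ifP; case: ifP; rewrite ?mcoeff0 ?mcoeffX ?(negPf km) ?mulr0.
  case: ifP => _; first by rewrite big1.
  by rewrite -raddf_sum -mpolyE.
have faceE p : face C p <-> phi p = 0.
  split=> [Cp|p0 m].
    apply/mpolyP => m; rewrite phiE mcoeff0; case: ifP => // nm.
    by apply/eqP; rewrite mcoeff_eq0; apply/negP => /Cp; rewrite nm.
  apply: contraLR => nm; rewrite -mcoeff_eq0.
  by have := phiE p m; rewrite p0 mcoeff0 (negPf nm) => <-.
split; first exact/mono_idealP/meets_up.
  by move/faceE/eqP; rewrite rmorph1 oner_eq0.
move=> a b /faceE/eqP; rewrite rmorphM mulf_eq0 => /orP[]/eqP/faceE; by [left|right].
Qed.

Lemma meetsU C i : meets C U_(i)%MM = (i \in C).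
Proof.
apply/existsP/idP=> [[j]|iC]; last by exists i; rewrite iC mnm1E eqxx.
by rewrite mnm1E; case: eqP => [->|]; rewrite ?andbT ?andbF.
Qed.

Lemma face_proper C C' : C \proper C' -> face C `<` face C'.
Proof.
case/properP=> /subsetP CC' [i iC' iC]; split.
  move=> p Cp m /Cp /existsP[j /andP[jC mj]]; apply/existsP; exists j.
  by rewrite mj CC'.
move=> /(_ 'X_i); rewrite /face !mono_idealX !meetsU iC' (negPf iC).
by move=> /(_ isT).
Qed.

(** Removing the variables of C one by one gives a chain of length |C|. Adding the other variables
    one by one extends a chain of length k below P_C to one of length k + n - |C|, which is at most
    n. *)
Lemma face_height C : has_height (face C) #|C|.
Proof.
split=> [|k].
  move: {2}#|C| (erefl #|C|) => k; elim: k C => [|k IH] C Ck; rewrite Ck.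
    by exists (fun=> face C); split=> // i _; apply: face_prime.
  have /card_gt0P[i iC] : (0 < #|C|)%N by rewrite Ck.
  have Ci : #|C :\ i| = k by apply/eqP; rewrite -eqSS -Ck (cardsD1 i C) iC.
  move: (IH _ Ci); rewrite Ci => /prime_chain_rcons; apply; first exact: face_prime.
  exact/face_proper/properD1.
move: {2}#|~: C| (erefl #|~: C|) => d; elim: d C k => [|d IH] C k Cd kC.
  have := cardsC C; rewrite Cd addn0 card_ord => ->; exact: prime_chain_leq kC.
have /card_gt0P[i] : (0 < #|~: C|)%N by rewrite Cd.
rewrite inE => iC.
have := IH (i |: C) k.+1; rewrite cardsU1 iC ltnS; apply.
  apply/eqP; rewrite -(eqn_add2l #|i |: C|) cardsC cardsU1 iC /= add1n addSnnS -Cd.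
  by rewrite cardsC.
apply: prime_chain_rcons kC (face_prime _) _; apply/face_proper/properP.
split; first exact: subsetUr.
by exists i; rewrite // !inE eqxx.
Qed.

(** It suffices that P contains the leading monomial of each of its nonzero elements ([lead], by
    induction on the number of terms of f): subtracting leading terms then reaches every monomial of
    g. *)
Lemma ass_graded M P f : upward M -> is_prime P ->
    P = [set a | mono_ideal M (a * f)] ->
  forall g m, P g -> m \in msupp g -> P 'X_[m].
Proof.
move=> upM Pp; have [Pid P1 PM] := Pp; have Iid := mono_idealP upM.
have lead k : forall f, (size (msupp f) <= k)%N ->
    P = [set a | mono_ideal M (a * f)] ->
    forall g, g != 0 -> P g -> P 'X_[mlead g].
  elim: k => [|k IH] {}f fk Pf g g0 Pg.
    move: fk; rewrite leqn0 size_eq0 msupp_eq0 => /eqP f0.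
    by case: P1; rewrite Pf /= f0 mulr0; case: Iid.
  have [//|nPg] := pselect (P 'X_[mlead g]).
  have [f0|f0] := eqVneq f 0.
    by case: P1; rewrite Pf /= f0 mulr0; case: Iid.
  (* If x^(lead g) is not in P, then x^(lead g) f has annihilator P too, and
     its leading term lies in I, so dropping it gives f2 with fewer terms. *)
  pose m := (mlead g + mlead f)%MM.
  have Mm : M m.
    have : mono_ideal M (g * f) by rewrite Pf in Pg.
    by apply; rewrite /m -mleadM // mlead_supp // mulf_neq0.
  pose f1 : R := f * 'X_[mlead g].
  have mf1 : m \in msupp f1.
    by rewrite (perm_mem (msuppMX _ _)) map_f // mlead_supp.
  pose f2 := f1 - f1@_m *: 'X_[m].
  apply: (IH f2) => //.
    rewrite (perm_size (msupp_rem _ _)) size_rem // (perm_size (msuppMX _ _)).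
    by rewrite size_map -subn1 leq_subLR add1n.
  have I2 a : mono_ideal M (a * (f1@_m *: 'X_[m])).
    by have [_ _ IM] := Iid; apply/IM/(idealZ _ Iid)/mono_idealX.
  apply/seteqP; split=> a; rewrite Pf /= => Ia.
    rewrite mulrBr; apply: (ideal_sub Iid) => //.
    by rewrite /f1 mulrA; apply: (ideal_mulr _ Iid).
  have : mono_ideal M (a * f1).
    by rewrite -(subrK (f1@_m *: 'X_[m]) f1) mulrDr; have [_ ID _] := Iid; apply: ID.
  rewrite /f1 [f * _]mulrC mulrA => Iaf.
  have : P (a * 'X_[mlead g]) by rewrite Pf.
  by case/PM=> //; rewrite {1}Pf.
move=> Pf g; move: {2}(size _) (leqnn (size (msupp g))) => k.
elim: k g => [|k IH] g gk m Pg mg.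
  by move: gk mg; rewrite leqn0 size_eq0 => /eqP->.
have [g0|g0] := eqVneq g 0; first by rewrite g0 msupp0 in mg.
have Pl := lead _ f (leqnn _) Pf g g0 Pg.
have [-> //|ml] := eqVneq m (mlead g).
apply: (IH (g - g@_(mlead g) *: 'X_[mlead g])).
- by rewrite (perm_size (msupp_rem _ _)) size_rem ?mlead_supp // -subn1 leq_subLR add1n.
- by apply: ideal_sub => //; apply: idealZ.
by rewrite (perm_mem (msupp_rem _ _)) (rem_filter _ (msupp_uniq _)) mem_filter /= ml.
Qed.

Lemma prime_monoX P m : is_prime P -> P 'X_[m] -> exists2 i, (0 < m i)%N & P 'X_i.
Proof.
move=> Pp; rewrite mpolyXE_id => /(prime_prod Pp)[i _ Pi]; exists i.
  by rewrite lt0n; apply/negP => /eqP m0; move: Pi; rewrite m0 expr0; case: Pp.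
exact: prime_exp Pi.
Qed.

(** P is spanned by monomials, so P = P_C for the set C of variables in P, and the witness f can be
    replaced by one of its monomials. *)
Lemma ass_mono_ideal M P : upward M ->
  associated_prime (mono_ideal M) P <->
  exists C m, P = face C /\ forall k, M (m + k)%MM = meets C k.
Proof.
move=> upM; split=> [[Pp [f Pf]]|[C [m [-> Mm]]]]; last first.
  split; first exact: face_prime.
  exists 'X_[m]; apply/seteqP; split=> p; rewrite /= mono_ideal_mulX /face.
    by move=> Cp k /Cp; rewrite Mm.
  by move=> Cp k /Cp; rewrite Mm.
have [Pid P1 PM] := Pp.
pose C := [set i | `[< P 'X_i >]]%SET.
have PC : P = face C.
  apply/seteqP; split=> p Pm.
    move=> m mp; have [i mi Pi] := prime_monoX Pp (ass_graded upM Pp Pf Pm mp).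
    by apply/existsP; exists i; rewrite inE mi andbT; apply/asboolP.
  apply: ideal_msupp => // m /Pm /existsP[i /andP[]].
  rewrite inE => /asboolP Pi mi; rewrite -(@submK _ U_(i)%MM m); last first.
    by apply/mnm_lepP => j; rewrite mnm1E; case: eqP => // <-.
  by rewrite mpolyXD; case: Pid => _ _; apply.
(* Otherwise each monomial m of f has a multiplier [T m] free of variables of C that carries it into
   the ideal. The product of these multipliers annihilates f, so lies in P_C, yet contains no
   variable of C. *)
have [m mf Hm] : exists2 m, m \in msupp f & forall k, M (m + k)%MM -> meets C k.
  apply: contrapT => nH.
  have /choice[T HT] m : exists k, m \in msupp f -> M (m + k)%MM /\ ~~ meets C k.
    apply: contrapT => nk; apply: nH; exists m.
      by apply: contrapT => mf; apply: nk; exists 0%MM => /mf.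
    by move=> k Mk; apply: contrapT => /negP Ck; apply: nk; exists k.
  pose S := (\sum_(m <- msupp f) T m)%MM.
  have : P 'X_[S].
    rewrite Pf /= mulrC mono_ideal_mulX => m mf.
    rewrite /S (big_rem m) //= addmC addmA; apply: upM.
    by have [] := HT _ mf.
  rewrite PC /face mono_idealX; apply/negP; rewrite /S big_seq.
  elim/big_ind: _ => [|a b na nb|m /HT[] //].
    by apply/existsP=> -[i]; rewrite mnm0E andbF.
  by rewrite meetsD negb_or na.
exists C, m; split=> // k; apply/idP/idP => [/Hm //|/existsP[i /andP[]]].
rewrite inE => /asboolP Pi ki.
have : M (m + U_(i))%MM.
  by move: Pi; rewrite Pf /= mulrC mono_ideal_mulX addmC; apply.
move=> Mi; have := upM _ (k - U_(i))%MM Mi; rewrite -addmA [(U_(i) + _)%MM]addmC submK //.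
by apply/mnm_lepP => j; rewrite mnm1E; case: eqP => // <-.
Qed.

End MonomialIdeals.

(** * Strong vertex covers and the associated primes of edge ideals *)

Section WeightedOrientedGraphs.
Variable n : nat.
Implicit Types (D : wographType n) (C : {set 'I_n}) (m : 'X_{1..n}).

(** The exponents of the monomials in I(D). Since x and y differ, divisibility by the generator of
    an edge amounts to two separate bounds. *)
Definition edge_mono D m :=
  [exists x, exists y, [&& edge D x y, 0 < m x & weight D y <= m y]]%N.

Lemma edge_monoP D m :
  reflect (exists x y, [/\ edge D x y, 0 < m x & weight D y <= m y]%N)
    (edge_mono D m).
Proof.
apply: (iffP existsP) => -[x].
  by case/existsP=> y /and3P H; exists x, y.
by case=> y /and3P H; exists x; apply/existsP; exists y.
Qed.

Lemma edge_mono_up D : upward (edge_mono D).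
Proof.
move=> m k /edge_monoP[x [y [xy mx my]]]; apply/edge_monoP; exists x, y.
by rewrite !mnmDE addn_gt0 mx (leq_trans my) ?leq_addr.
Qed.

Lemma edge_neq D x y : edge D x y -> x != y.
Proof. by apply: contraL => /eqP->; apply: edge_irrefl. Qed.

Lemma wo_edge_idealE (K : fieldType) D :
  wo_edge_ideal K D = mono_ideal (edge_mono D).
Proof.
have genE x y : 'X_x * 'X_y ^+ weight D y =
    'X_[(U_(x) + U_(y) *+ weight D y)] :> {mpoly K[n]}.
  by rewrite mpolyXD mpolyXn.
apply/seteqP; split=> p.
  apply; split; first exact/mono_idealP/edge_mono_up.
  move=> _ [x [y [xy ->]]]; rewrite genE mono_idealX.
  apply/edge_monoP; exists x, y; rewrite !mnmDE !mulmnE !mnm1E !eqxx.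
  by split=> //; lia.
move=> Mp; apply: ideal_msupp; first exact: ideal_genP.
move=> m /Mp /edge_monoP[x [y [xy mx my]]].
rewrite -(@submK _ (U_(x) + U_(y) *+ weight D y)%MM m); last first.
  apply/mnm_lepP => i; rewrite mnmDE mulmnE !mnm1E; move: mx my (edge_neq xy).
  by case: (eqVneq x i) => [->|_]; case: (eqVneq y i) => [->|_]; rewrite ?eqxx //=; lia.
rewrite mpolyXD -genE; case: (ideal_genP [set p : {mpoly K[n]} |
  exists x y, edge D x y /\ p = 'X_x * 'X_y ^+ weight D y]) => _ _; apply.
by move=> J [_]; apply; exists x, y.
Qed.

Lemma in_L1P D C x :
  reflect (x \in C /\ exists2 y, edge D x y & y \notin C) (x \in L1 D C).
Proof.
rewrite inE; apply: (iffP andP) => -[xC].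
  by case/set0Pn=> y; rewrite !inE => /andP[]; split=> //; exists y.
by case=> y xy yC; split=> //; apply/set0Pn; exists y; rewrite !inE xy.
Qed.

Lemma in_L3P D C x :
  reflect (x \in C /\ forall y, edge D x y || edge D y x -> y \in C)
    (x \in L3 D C).
Proof.
rewrite !inE negb_or !negb_and; apply: (iffP idP).
  case/andP=> /andP[] H1 H2 xC; move: H1 H2; rewrite xC /= negbK => /eqP o0.
  rewrite o0 eqxx /= negbK => /eqP i0; split=> // y xy; apply/negPn/negP => yC.
  case/orP: xy => xy; [move/setP/(_ y): o0|move/setP/(_ y): i0].
    by rewrite !inE xy yC.
  by rewrite !inE xy yC.
case=> xC H; rewrite xC /= andbT.
have -> : Nout D x :&: ~: C = finset.set0.
  by apply/setP => y; rewrite !inE; apply/negP => /andP[xy]; rewrite H ?xy.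
have -> : Nin D x :&: ~: C = finset.set0.
  by apply/setP => y; rewrite !inE; apply/negP => /andP[xy]; rewrite H ?xy ?orbT.
by rewrite eqxx.
Qed.

Lemma in_L23 D C x : (x \in L2 D C :|: L3 D C) = (x \in C) && (x \notin L1 D C).
Proof.
rewrite in_setU [x \in L3 D C]in_setD in_setU negb_or.
rewrite [x \in L2 D C]inE.
by case: (x \in C); case: (x \in L1 D C) => //=; case: (_ != _).
Qed.

Lemma vertex_coverP D C :
  reflect (forall x y, edge D x y -> (x \in C) || (y \in C)) (vertex_cover D C).
Proof.
apply: (iffP forallP) => [H x y|H x]; first by have /forallP/(_ y)/implyP := H x.
by apply/forallP => y; apply/implyP; apply: H.
Qed.

(** The right-hand side says (I(D) : x^m) = P_C, as in [ass_mono_ideal]. *)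
Lemma strong_vertex_coverP D C :
  strong_vertex_cover D C <->
  exists m, forall k, edge_mono D (m + k)%MM = meets C k.
Proof.
split=> [/andP[/vertex_coverP vC sC]|[m0 m0E]].
  (* On L2 and L3, w - 1 falls one short of an edge into i, so multiplying by x_i completes it. For
     i in L3 the tail y of that edge needs w(y) - 1 > 0, that is, y in [Vplus]. *)
  pose m := [multinom if i \notin C then weight D i else
               if i \in L1 D C then 0%N else (weight D i).-1 | i < n].
  exists m => k; apply/edge_monoP/existsP => [[x [y]]|[i /andP[iC ki]]].
    rewrite !mnmDE !mnmE => -[xy mx my].
    have := vC _ _ xy; have := weight_gt0 D y.
    case yC: (y \in C) mx my => /= mx my wy.
      case: (posnP (k y)) => [ky|ky _]; last by exists y; rewrite yC.
      by move: my wy; rewrite ky addn0; case: ifP => _; lia.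
    rewrite orbF => xC; exists x; rewrite xC; move: mx; rewrite xC /=.
    suff -> : x \in L1 D C by [].
    by apply/in_L1P; split=> //; exists y; rewrite ?yC.
  have wP := weight_gt0 D.
  case: (boolP (i \in L1 D C)) => iL1.
    have /in_L1P[_ [y iy yC]] := iL1; exists i, y; rewrite !mnmDE !mnmE yC.
    by split=> //; [rewrite addn_gt0 ki orbT|apply: leq_addr].
  have wi : (weight D i <= (m + k)%MM i)%N.
    by rewrite mnmDE mnmE iC /= (negPf iL1); have := wP i; lia.
  have [/in_L3P iL3|] := boolP (i \in L3 D C).
    have /forall_inP/(_ i)/(_ (introT (in_L3P _ _ _) iL3))/existsP[y] := sC.
    case/and3P=> yi; rewrite in_L23 [_ \in Vplus D]inE => /andP[yC yL1] wy; exists y, i.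
    split=> //; rewrite mnmDE mnmE yC /= (negPf yL1).
    by have := wP y; move/eqP: wy; lia.
  move=> iL3; have : i \in L2 D C :|: L3 D C by rewrite in_L23 iC.
  rewrite in_setU (negPf iL3) orbF [_ \in L2 _ _]inE => /and3P[_ _ /set0Pn[y]].
  rewrite !inE => /andP[yi yC]; exists y, i; split=> //.
  by rewrite mnmDE mnmE yC; have := wP y; lia.
(* As b vanishes on C, adding it preserves the hypothesis and gives m >= w off C. *)
pose b := [multinom if i \in C then 0%N else weight D i | i < n].
have [m mE m_out] : exists2 m, forall k, edge_mono D (m + k)%MM = meets C k
    & forall i, i \notin C -> (weight D i <= m i)%N.
  exists (m0 + b)%MM => [k|i iC]; last first.
    by rewrite mnmDE mnmE (negPf iC) leq_addl.
  rewrite -addmA m0E meetsD; suff /negPf-> : ~~ meets C b by [].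
  by apply/existsP => -[i /andP[iC]]; rewrite mnmE iC.
have no_edge x y : edge D x y -> (0 < m x)%N -> (m y < weight D y)%N.
  move=> xy mx; rewrite ltnNge; apply/negP => my.
  have := mE 0%MM; rewrite addm0; have -> : edge_mono D m.
    by apply/edge_monoP; exists x, y.
  by move/esym/existsP=> [i /andP[_]]; rewrite mnm0E.
have has_edge i : i \in C -> exists x y,
    [/\ edge D x y, 0 < m x + (i == x) & weight D y <= m y + (i == y)]%N.
  move=> iC; have := mE U_(i)%MM; rewrite meetsU iC => /edge_monoP[x [y]].
  by rewrite !mnmDE !mnm1E => H; exists x, y.
have wP := weight_gt0 D.
(* If m i >= w(i), the factor x_i creates no new edge, and x^m would already lie in I(D). *)
have m_in i : i \in C -> (m i < weight D i)%N.
  move=> iC; have [x [y [xy mx my]]] := has_edge i iC; have xNy := edge_neq xy.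
  rewrite ltnNge; apply/negP => mi.
  have {}mx : (0 < m x)%N.
    by case: eqP mx => [<-|_]; rewrite ?addn0 // => _; apply: leq_trans (wP i) mi.
  have {}my : (weight D y <= m y)%N.
    by case: eqP my => [<-|_]; rewrite ?addn0.
  by have := no_edge _ _ xy mx; rewrite ltnNge my.
apply/andP; split.
  apply/vertex_coverP => x y xy; apply: contraT; rewrite negb_or => /andP[xC yC].
  have := no_edge _ _ xy (leq_trans (wP x) (m_out _ xC)).
  by rewrite ltnNge m_out.
apply/forall_inP => x /in_L3P[xC xN].
(* If x = a, then b' is in C and violates [m_in]. Hence x = b', and 0 < m a < w(a) puts a in
   [Vplus]; an edge from a out of C would put x^m in I(D), so a is not in L1. *)
have [a [b' [ab ma mb]]] := has_edge x xC.
have [xa|xa] := eqVneq x a.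
  have xNb : x != b' by rewrite xa (edge_neq ab).
  move: mb; rewrite (negPf xNb) addn0 leqNgt m_in //.
  by apply: xN; rewrite xa ab.
move: ma; rewrite (negPf xa) addn0 => ma.
have [xb|xb] := eqVneq x b'; last first.
  by move: mb; rewrite (negPf xb) addn0 leqNgt (no_edge _ _ ab).
subst b'; have aC : a \in C by apply: xN; rewrite ab orbT.
apply/existsP; exists a; rewrite ab in_L23 aC [_ \in Vplus D]inE /=.
apply/andP; split; last by have := m_in _ aC; move: ma; case: eqP => // ->; lia.
apply/negP => /in_L1P[_ [z az zC]].
by have := no_edge _ _ az ma; rewrite ltnNge m_out.
Qed.

Lemma unmixedP (K : fieldType) D :
  unmixed (wo_edge_ideal K D) <->
  (forall C C', strong_vertex_cover D C -> strong_vertex_cover D C' ->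
     #|C| = #|C'|).
Proof.
have assE P : associated_prime (wo_edge_ideal K D) P <->
    exists2 C, strong_vertex_cover D C & P = @face K n C.
  rewrite wo_edge_idealE ass_mono_ideal; last exact: edge_mono_up.
  split=> [[C [m [PC mE]]]|[C /strong_vertex_coverP[m mE] PC]].
    by exists C => //; apply/strong_vertex_coverP; exists m.
  by exists C, m.
split=> [unm C C' sC sC'|eqC P Q /assE[C sC ->] /assE[C' sC' ->] h].
  have aC : associated_prime (wo_edge_ideal K D) (@face K n C) by apply/assE; exists C.
  have aC' : associated_prime (wo_edge_ideal K D) (@face K n C') by apply/assE; exists C'.
  have /(unm _ _ aC aC') hC' := face_height K C.
  exact: has_height_inj hC' (face_height K C').
have cC := eqC _ _ sC sC'.
split=> hh; have := has_height_inj hh (face_height K _) => ->; [rewrite cC|rewrite -cC];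
 exact: face_height.
Qed.

(** Weight 1 turns I(D) into I(G), so that [unmixedP] also applies to I(G). *)
Definition unweighted D : wographType n :=
  WOGraph (weight := fun=> 1%N) (@edge_irrefl n D) (@edge_oriented n D)
    (fun=> isT).

Lemma edge_ideal_unweighted (K : fieldType) D :
  edge_ideal K (underlying D) = wo_edge_ideal K (unweighted D).
Proof.
congr (ideal_gen _); apply/seteqP; split=> p [x [y [xy ->]]] /=.
  case/orP: xy => xy; [exists x, y|exists y, x]; split=> //.
  by rewrite expr1 mulrC.
by exists x, y; rewrite expr1 /underlying xy.
Qed.

(** [Vplus] is empty for weight 1, so no vertex of L3 can satisfy the strongness condition. *)
Lemma strong_unweighted D C :
  strong_vertex_cover (unweighted D) C =
  vertex_cover D C && (L3 D C == finset.set0).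
Proof.
congr (_ && _); apply/forall_inP/eqP => [H|L0 x]; last by rewrite [L3 _ _]L0 inE.
apply/setP => x; rewrite in_set0; apply/negP => /H /existsP[y].
by rewrite [_ \in Vplus _]inE eqxx !andbF.
Qed.

Lemma strong_of_L3_eq0 D C :
  vertex_cover D C -> L3 D C = finset.set0 -> strong_vertex_cover D C.
Proof.
move=> vC L0; rewrite /strong_vertex_cover vC L0.
by apply/forall_inP => x; rewrite inE.
Qed.

(** A vertex of L3 has all its neighbours in C, so deleting it leaves a cover; this is repeated
    until L3 is empty. *)
Lemma cover_sub_L3_eq0 D C : vertex_cover D C ->
  exists C', [/\ C' \subset C, vertex_cover D C' & L3 D C' = finset.set0].
Proof.
move: {2}#|C| (leqnn #|C|) => k; elim: k C => [|k IH] C Ck vC.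
  exists C; split=> //; apply/setP => x; rewrite in_set0; apply/negP => /in_L3P[xC _].
  by move: Ck; rewrite leqn0 => /eqP/cards0_eq C0; rewrite C0 inE in xC.
have [L0|[x /in_L3P[xC xN]]] := set_0Vmem (L3 D C); first by exists C.
have [||C' [C'C vC' L0]] := IH (C :\ x).
- by move: Ck; rewrite (cardsD1 x C) xC.
- apply/vertex_coverP => y z yz; rewrite !inE.
  have [yx|yx] := eqVneq y x.
    by rewrite (xN z) -yx ?yz // eq_sym (edge_neq yz) orbT.
  have [zx|zx] := eqVneq z x; first by rewrite (xN y) -?zx ?yz ?orbT.
  by have /vertex_coverP/(_ _ _ yz) := vC.
by exists C'; split=> //; apply: subset_trans C'C (subsetDl _ _).
Qed.

End WeightedOrientedGraphs.

Theorem theorem4p2 (K : fieldType) (n : nat) (D : wographType n)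
    (source_weight : forall x : 'I_n, source D x -> weight D x = 1%N) :
  (unmixed (wo_edge_ideal K D) <->
   (forall C C' : {set 'I_n},
      strong_vertex_cover D C -> strong_vertex_cover D C' -> #|C| = #|C'|))
  /\
  ((forall C C' : {set 'I_n},
      strong_vertex_cover D C -> strong_vertex_cover D C' -> #|C| = #|C'|) <->
   (unmixed (edge_ideal K (underlying D)) /\
    (forall C : {set 'I_n}, strong_vertex_cover D C -> L3 D C = set0))).
Proof.
split; first exact: unmixedP.
rewrite edge_ideal_unweighted unmixedP; split=> [eqC|[eqC L0] C C' sC sC'].
  split=> [C C'|C sC].
    rewrite !strong_unweighted => /andP[vC /eqP L0] /andP[vC' /eqP L0'].
    by apply: eqC; apply: strong_of_L3_eq0.
  (* The smaller cover C' is strong as well, so it has the cardinality of C and equals C. *)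
  have /andP[vC _] := sC; have [C' [C'C vC' L0']] := cover_sub_L3_eq0 vC.
  suff -> : C = C' by [].
  apply/esym/eqP; rewrite eqEcard C'C /= (eqC C C') //.
  exact: strong_of_L3_eq0.
(* With L3 empty, strong covers of D stay strong for weight 1, where unmixedness of I(G) equates
   their cardinalities. *)
have strong_L0 A : strong_vertex_cover D A -> strong_vertex_cover (unweighted D) A.
  by move=> sA; rewrite strong_unweighted L0 // eqxx andbT; case/andP: sA.
by apply: eqC; apply: strong_L0.
Qed.
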